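(* Let $n\ge 3$ be an integer such that $n=bq$ with $b,q$ positive integers, $b\ge 2$, and assume that $n\equiv q \pmod 2$. Fix $x=(1\ 2\ \ldots\ n)\in S_n$. Then $$\frac{N(b,q)}{T(b,q)}\ \ge\ \frac{2}{n+2}.$$ In particular, the inequality becomes an equality when $b=2$.
   Context: $S_n$ is the symmetric group on $\{1,\dots,n\}$. For $n=bq$, a permutation in $S_n$ has cycle type $(b^{q})$ if it consists of $q$ disjoint cycles of length $b$, and cycle type $(n)$ if it is an $n$-cycle. $T(b,q)$ denotes the number of permutations in $S_n$ of cycle type $(b^{q})$, and $N(b,q)$ denotes the number of permutations $y\in S_n$ of cycle type $(b^{q})$ such that $xy$ has cycle type $(n)$, where $x=(1\ 2\ \ldots\ n)$ is fixed. *)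

(* Defs.v *)
From mathcomp Require Import all_boot all_order all_algebra all_fingroup.

Set Implicit Arguments.
Unset Strict Implicit.
Unset Printing Implicit Defensive.

(* The porbits of a permutation include its fixed points, so they are exactly
   its cycles with cycles of length 1 counted. *)
Definition has_rect_cycle_type (n b q : nat) (s : 'S_n) : bool :=
  (#|porbits s| == q) && [forall C in porbits s, #|C| == b].

Definition is_n_cycle (n : nat) (s : 'S_n) : bool := has_rect_cycle_type n 1 s.

(* The cycle (1 2 ... n), with the points numbered 0, ..., n - 1:
   i is sent to (i + 1) mod n. *)
Definition long_cycle (n : nat) : 'S_n := perm (@ordS_inj n).

Definition T (n b q : nat) : nat :=
  #|[set y : 'S_n | has_rect_cycle_type b q y]|.

(* The product (x * y)%g of permutations applies x first; since x y and y x are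
   conjugate, the count does not depend on this convention. *)
Definition N (n b q : nat) : nat :=
  #|[set y : 'S_n | has_rect_cycle_type b q y
                    & is_n_cycle (long_cycle n * y)%g]|.

(* Main.v *)
Require Import Defs.
From HB Require Import structures.
From mathcomp Require Import all_boot all_order all_algebra all_fingroup.
From mathcomp Require Import all_field all_character.
From mathcomp Require Import zify ring.
Import Order.TTheory GRing.Theory Num.Theory.
Set Implicit Arguments.
Unset Strict Implicit.
Unset Printing Implicit Defensive.
Local Open Scope group_scope.
Local Open Scope ring_scope.

(* The n hook characters of S_n (the exterior powers of the standard
   representation) are orthonormal, and their alternating sum is n times the
   indicator function of the n-cycles.  Frobenius' formula for products of two
   conjugacy classes then gives, for y with cycles C,
     #{x | x and x y are n-cycles} / (n - 1)!
       = \int_0^1 \prod_C ((1 - t)^|C| - (-t)^|C|) dt,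
   so that N / T = \int_0^1 ((1 - t)^b - (-t)^b)^q dt.  In the variable
   D = 1 - 2t the integrand is an even polynomial \sum_i f_i D^i with f_i >= 0,
   \sum_i f_i = 1 and \sum_i i f_i = n / 2, and its integral is
   \sum_i f_i / (i + 1) >= 1 / (n / 2 + 1) by convexity.  If b = 2, the integrand
   is D^q. *)

(** * The integral over [0, 1] of a polynomial *)

Section UnitIntegral.
Variable F : numFieldType.
Implicit Types (p q f : {poly F}) (b k l : nat).

Definition integral01 p : F := \sum_(i < size p) p`_i / i.+1%:R.

Lemma integral01_wide p m : (size p <= m)%N ->
  integral01 p = \sum_(i < m) p`_i / i.+1%:R.
Proof.
move=> le_pm; rewrite /integral01 (big_ord_widen m (fun i => p`_i / i.+1%:R)) //.
rewrite big_mkcond /=; apply: eq_bigr => i _; case: ltnP => // le_pi.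
by rewrite nth_default ?mul0r.
Qed.

Fact integral01_is_linear : linear_for *%R integral01.
Proof.
move=> a p q; pose m := maxn (size p) (size q).
rewrite !(@integral01_wide _ m) ?leq_maxl ?leq_maxr //; last first.
  by rewrite (leq_trans (size_polyD _ _)) // geq_max leq_maxr
     (leq_trans (size_scale_leq _ _)) ?leq_maxl.
rewrite mulr_sumr -big_split; apply: eq_bigr => i _ /=.
by rewrite coefD coefZ mulrDl mulrA.
Qed.
HB.instance Definition _ :=
  GRing.isLinear.Build F {poly F} F *%R integral01 integral01_is_linear.

Lemma integral01Xn k : integral01 'X^k = k.+1%:R^-1.
Proof.
rewrite (@integral01_wide _ k.+1) ?size_polyXn // big_ord_recr /= coefXn eqxx.
rewrite mul1r big1 ?add0r // => i _.
by rewrite coefXn ltn_eqF ?mul0r.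
Qed.

Lemma integral01_deriv p : integral01 p^`() = p.[1] - p.[0].
Proof.
have h k : integral01 ('X^k)^`() = ('X^k).[1] - ('X^k).[0].
  rewrite derivXn !hornerXn expr1n expr0n; case: k => [|k] /=.
    by rewrite mulr0n linear0 subrr.
  by rewrite subr0 linearMn /= integral01Xn -[LHS]mulr_natl divff ?pnatr_eq0.
rewrite -[p in LHS]coefK -[p in RHS]coefK poly_def.
rewrite (linear_sum (@deriv F)) linear_sum /= !horner_sum -sumrB.
apply: eq_bigr => i _; rewrite derivZ linearZ /= h !hornerZ; ring.
Qed.

(** Induction on [l] by parts: the derivative of ['X^(k+1) (1 - 'X)^(l+1)] integrates to 0, both
    endpoint values being 0. With [k + l = n - 1] the value is the reciprocal of [n] times the
    degree of a hook character. *)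
Lemma integral01_beta k l :
  integral01 ('X^k * (1 - 'X) ^+ l) = ((k + l).+1 * 'C(k + l, k))%:R^-1.
Proof.
elim: l k => [|l IH] k.
  by rewrite expr0 mulr1 addn0 binn muln1 integral01Xn.
have := integral01_deriv ('X^(k.+1) * (1 - 'X) ^+ l.+1).
rewrite !hornerE /= !expr0n mul0r subrr expr0n mulr0 subr0.
rewrite derivM derivXn deriv_exp derivB derivC derivX sub0r /=.
have -> : 'X^k *+ k.+1 * (1 - 'X) ^+ l.+1 +
   'X^(k.+1) * ((- 1) * (1 - 'X) ^+ l *+ l.+1) =
   (k.+1%:R : F) *: ('X^k * (1 - 'X) ^+ l.+1) -
   (l.+1%:R : F) *: ('X^(k.+1) * (1 - 'X) ^+ l) :> {poly F}.
  rewrite !scaler_nat; ring.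
rewrite linearB /= !linearZ /= IH => /eqP; rewrite subr_eq0 => /eqP E.
apply: (@mulfI _ k.+1%:R); first by rewrite pnatr_eq0.
rewrite E addSnnS; have := mul_bin_left (k + l.+1) k.
rewrite addKn => /(congr1 (fun m => m%:R : F)); rewrite !natrM => H.
have nz : 'C(k + l.+1, k)%:R != 0 :> F by rewrite pnatr_eq0 -lt0n bin_gt0 leq_addr.
have -> : 'C(k + l.+1, k.+1)%:R = l.+1%:R * 'C(k + l.+1, k)%:R / k.+1%:R :> F.
  by rewrite -H mulrC mulKf ?pnatr_eq0.
by field; rewrite nz !nat1r -natrD nat1r !pnatr_eq0.
Qed.

(** The substitution [D = 1 - 2t] yields the mean of [f] over [-1, 1], which for even [f] is its
    integral over [0, 1]. *)
Lemma integral01_comp_1B2X f :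
  (forall i, odd i -> f`_i = 0) -> integral01 (f \Po (1 - 'X *+ 2)) = integral01 f.
Proof.
move=> fodd; rewrite comp_polyE linear_sum; apply: eq_bigr => i _.
rewrite linearZ /=; case oi: (odd i); first by rewrite fodd // !mul0r.
congr (_ * _); have := integral01_deriv ((1 - 'X *+ 2) ^+ i.+1).
rewrite deriv_exp derivB derivMn derivC derivX sub0r /= !hornerE.
have -> : (1 - 2 : F) = -1 by ring.
rewrite subr0 expr1n exprS -signr_odd oi expr0.
have -> : (- (1 *+ 2) * (1 - 'X *+ 2) ^+ i *+ i.+1) =
    (- (i.+1%:R * 2)) *: (1 - 'X *+ 2) ^+ i :> {poly F}.
  by rewrite scaleNr -natrM scaler_nat; ring.
rewrite linearZ /= => E; apply: (@mulfI _ (- (i.+1%:R * 2))).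
  by rewrite oppr_eq0 mulf_neq0 ?pnatr_eq0.
by rewrite E; field; rewrite nat1r; apply/eqP/eqP; rewrite pnatr_eq0.
Qed.

(* Jensen for the probability weights [f`_i] of mean [M] and the convex function
   [1 / (i + 1)], via its tangent line at [M]. *)
Lemma integral01_jensen f (M : F) :
    0 <= M -> (forall i, 0 <= f`_i) -> f.[1] = 1 -> f^`().[1] = M ->
  (M + 1)^-1 <= integral01 f.
Proof.
move=> M0 f0 f1 fM; have M1 : M + 1 != 0 by rewrite gt_eqF // ltr_wpDl.
have -> : (M + 1)^-1 = \sum_(i < size f) f`_i * ((M + 1)^-1 - (i%:R - M) / (M + 1) ^+ 2).
  have s1 : \sum_(i < size f) f`_i = 1.
    by rewrite -f1 horner_coef; apply: eq_bigr => i _; rewrite expr1n mulr1.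
  have sM : \sum_(i < size f) f`_i * i%:R = M.
    rewrite -fM -[f in RHS]coefK poly_def (linear_sum (@deriv F)) horner_sum.
    apply: eq_bigr => i _; rewrite /= derivZ derivXn hornerZ hornerMn hornerXn expr1n.
    by rewrite mulr_natr.
  rewrite (eq_bigr (fun i : 'I__ => f`_i * ((M + 1)^-1 + M / (M + 1) ^+ 2)
     - f`_i * i%:R / (M + 1) ^+ 2)); last by move=> i _; ring.
  by rewrite sumrB -!mulr_suml s1 sM; ring.
apply: ler_sum => i _; apply: ler_wpM2l => //; rewrite -subr_ge0.
have i1 : i.+1%:R != 0 :> F by rewrite pnatr_eq0.
have -> : i.+1%:R^-1 - ((M + 1)^-1 - (i%:R - M) / (M + 1) ^+ 2) =
  (i%:R - M) ^+ 2 / (i.+1%:R * (M + 1) ^+ 2) :> F.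
  by rewrite -natr1 in i1 *; field; rewrite i1 M1.
apply: divr_ge0; first by rewrite real_exprn_even_ge0 // rpredB ?realn ?ger0_real.
by rewrite mulr_ge0 ?ler0n ?exprn_ge0 ?addr_ge0 ?ler01.
Qed.

Lemma coef_exp_ge0 p k : (forall i, 0 <= p`_i) -> forall i, 0 <= (p ^+ k)`_i.
Proof.
move=> p0; elim: k => [|k IH] i; first by rewrite expr0 coef1 ler0n.
by rewrite exprS coefM sumr_ge0 // => j _; rewrite mulr_ge0.
Qed.

Lemma coef_XaddC_exp (c : F) k i : (('X + c%:P) ^+ k)`_i = c ^+ (k - i) *+ 'C(k, i).
Proof.
rewrite addrC exprDn coef_sum; have [lt_ki | le_ik] := ltnP k i.
  rewrite bin_small ?mulr0n // big1 // => j _.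
  rewrite coefMn -polyC_exp coefCM coefXn gtn_eqF ?mulr0 ?mul0rn //.
  exact: leq_trans (ltn_ord j) lt_ki.
rewrite (bigD1 (inord i)) //= inordK // big1 ?addr0 => [|j ne_ji].
  by rewrite coefMn -polyC_exp coefCM coefXn eqxx mulr1.
rewrite coefMn -polyC_exp coefCM coefXn eq_sym.
have /negPf-> : (j : nat) != i.
  by apply: contraNneq ne_ji => <-; rewrite inord_val.
by rewrite mulr0 mul0rn.
Qed.

Lemma coef_comp_NX p i : (p \Po (- 'X))`_i = (-1) ^+ i * p`_i.
Proof.
rewrite comp_polyE coef_sum; have cE (j : nat) :
    (p`_j *: (- 'X) ^+ j)`_i = (i == j)%:R * ((-1) ^+ i * p`_i).
  rewrite coefZ -scaleN1r exprZn coefZ coefXn.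
  by case: eqVneq => [->|_]; rewrite ?mulr0 ?mul0r // mulr1 mul1r mulrC.
rewrite (eq_bigr _ (fun (j : 'I_(size p)) _ => cE j)); have [lt_ip | le_pi] := ltnP i (size p).
  rewrite (bigD1 (Ordinal lt_ip)) //= eqxx mul1r big1 ?addr0 // => j.
  by rewrite -val_eqE eq_sym /= => /negPf->; rewrite mul0r.
rewrite big1 => [|j _]; first by rewrite (nth_default _ le_pi) mulr0.
by rewrite gtn_eqF ?mul0r // (leq_trans (ltn_ord j)).
Qed.

Lemma rect_integral_ge b (q : nat) : (1 < b)%N -> ~~ odd (b * q + q) ->
  2 / (b * q + 2)%:R <= integral01 (((1 - 'X) ^+ b - (- 'X) ^+ b) ^+ q).
Proof.
move=> b1 par; pose h : F := 2^-1.
(* With [D = 1 - 2t] one has [1 - t = (D + 1) / 2] and [- t = (D - 1) / 2], so [g] is the base of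
   the integrand as a polynomial in [D]. *)
pose g := h ^+ b *: (('X + 1) ^+ b - ('X - 1) ^+ b) : {poly F}.
have h2 : h * 2 = 1 by rewrite /h mulVf ?pnatr_eq0.
have gE : g \Po (1 - 'X *+ 2) = (1 - 'X) ^+ b - (- 'X) ^+ b.
  rewrite comp_polyZ comp_polyB !(rmorphXn (comp_poly _)) /=.
  rewrite comp_polyD comp_polyB comp_polyX comp_polyC.
  have -> : 1 - 'X *+ 2 + 1 = 2 *: (1 - 'X) :> {poly F} by rewrite scaler_nat; ring.
  have -> : 1 - 'X *+ 2 - 1 = 2 *: (- 'X) :> {poly F} by rewrite scaler_nat; ring.
  by rewrite !exprZn -scalerBr scalerA -exprMn h2 expr1n scale1r.
(* The coefficient is [2^-b C(b, i) (1 - (-1)^(b - i))], whose last factor is 0 or 2 when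
   [i <= b]. *)
have g0 i : 0 <= g`_i.
  rewrite coefZ coefB mulr_ge0 ?exprn_ge0 ?invr_ge0 ?ler0n //.
  rewrite -polyC1 -polyCN !coef_XaddC_exp -mulrnBl mulrn_wge0 //.
  by rewrite expr1n subr_ge0 -signr_odd; case: odd;
    rewrite ?lexx // (le_trans (lerN10 _) ler01).
have gN : g \Po (- 'X) = (-1) ^+ b.+1 *: g.
  rewrite comp_polyZ comp_polyB !(rmorphXn (comp_poly _)) /=.
  rewrite comp_polyD comp_polyB comp_polyX comp_polyC.
  have -> : - 'X + 1 = (-1) *: ('X - 1) :> {poly F} by rewrite scaleN1r; ring.
  have -> : - 'X - 1 = (-1) *: ('X + 1) :> {poly F} by rewrite scaleN1r; ring.
  rewrite !exprZn -scalerBr !scalerA mulrC; rewrite -[_ - _]opprB scalerN -scaleNr.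
  by rewrite exprS !mulN1r mulNr.
(* By [gN], replacing [D] by [- D] multiplies [g ^+ q] by [(-1)^((b + 1) q)], which is 1 by
   [par]. *)
have fodd i : odd i -> (g ^+ q)`_i = 0.
  move=> oi; have : (g ^+ q) \Po (- 'X) = g ^+ q.
    rewrite (rmorphXn (comp_poly _)) /= gN exprZn -exprM -signr_odd mulSn addnC (negPf par).
    by rewrite expr0 scale1r.
  move/(congr1 (fun p : {poly F} => p`_i)).
  rewrite coef_comp_NX.
  rewrite -signr_odd oi mulN1r => /eqP; rewrite eq_sym -subr_eq0 opprK -mulr2n.
  by rewrite mulrn_eq0 => /eqP.
rewrite -gE -(rmorphXn (comp_poly _)) /= integral01_comp_1B2X //.
have g1 : g.[1] = 1.
  rewrite !hornerE subrr expr0n gtn_eqF 1?ltnW // subr0 -exprMn.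
  by rewrite -[1 + 1]/(2%:R : F) h2 expr1n.
(* Since [b >= 2], the power [(D - 1)^(b - 1)] vanishes at 1, leaving [b 2^(b - 1) / 2^b]. Hence the
   mean for [g ^+ q] is [b q / 2]. *)
have gd1 : g^`().[1] = b%:R / 2.
  rewrite derivZ derivB !deriv_exp derivD derivB derivX derivC !hornerE.
  rewrite !hornerMn !hornerE subrr expr0n; case: (b) b1 => [|[|c]] //= _.
  rewrite mulr0n mulr0 mul0rn subr0 -[1 + 1]/(2 : F) exprS mulrnAr -mulrA -exprMn h2.
  by rewrite expr1n mulr1 -mulr_natl.
have -> : 2 / (b * q + 2)%:R = ((b * q)%:R / 2 + 1)^-1 :> F.
  rewrite natrD; field.
  by rewrite -natrM -natrD pnatr_eq0 addn2.
apply: integral01_jensen; first by rewrite divr_ge0 ?ler0n.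
- exact: coef_exp_ge0.
- by rewrite horner_exp g1 expr1n.
- by rewrite deriv_exp hornerMn hornerM horner_exp g1 expr1n mulr1 gd1 natrM -mulr_natr mulrAC.
Qed.

Lemma rect2_integral (q : nat) : ~~ odd q ->
  integral01 (((1 - 'X) ^+ 2 - (- 'X) ^+ 2) ^+ q) = 2 / (2 * q + 2)%:R.
Proof.
move=> eq; have -> : (1 - 'X) ^+ 2 - (- 'X) ^+ 2 = 1 - 'X *+ 2 :> {poly F} by ring.
have -> : (1 - 'X *+ 2) ^+ q = 'X^q \Po (1 - 'X *+ 2) :> {poly F}.
  by rewrite (rmorphXn (comp_poly _)) /= comp_polyX.
rewrite integral01_comp_1B2X ?integral01Xn; last first.
  by move=> i oi; rewrite coefXn; case: eqP oi eq => // -> ->.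
by rewrite -mulnSr natrM invfM mulrA divff ?mul1r ?pnatr_eq0.
Qed.

End UnitIntegral.

(** * Subsets invariant under a permutation *)

Section InvariantSubsets.
Variable T : finType.
Implicit Types (g h : {perm T}) (S : {set T}) (P : {set {set T}}).

Lemma porbits_partition g : partition (porbits g) setT.
Proof.
have -> : porbits g = orbit 'P <[g]> @: setT.
  by apply/setP => C; apply/imsetP/imsetP => -[x _ ->]; exists x; rewrite ?porbitE.
by apply: orbit_partition; apply/actsP => a _ x; rewrite !inE.
Qed.

Lemma porbitsP g C x : C \in porbits g -> x \in C -> C = porbit g x.
Proof. by case/imsetP => y _ -> xy; apply/esym/eqP; rewrite eq_porbit_mem. Qed.

Lemma porbit_sub_invariant g S x :
  g \in 'N(S | 'P) -> x \in S -> porbit g x \subset S.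
Proof.
move=> gS xS; apply/subsetP => y /porbitP[i ->].
by have /astabsP/(_ x) := groupX i gS; rewrite /= apermE xS.
Qed.

(** This and the next two lemmas make [cover] and [imset (porbit g)] inverse bijections between sets
    of cycles of [g] and [g]-invariant sets. *)
Lemma cover_porbits_invariant g P :
  P \subset porbits g -> g \in 'N(cover P | 'P).
Proof.
move=> sP; apply/astabsP => x /=; rewrite apermE.
apply/bigcupP/bigcupP => -[C CP xC]; exists C => //.
  have CE := porbitsP (subsetP sP _ CP) xC.
  by rewrite CE porbit_sym; apply: (mem_porbit g 1).
have -> := porbitsP (subsetP sP _ CP) xC.
exact: (mem_porbit g 1).
Qed.

Lemma cover_porbit_imset g S : g \in 'N(S | 'P) -> cover (porbit g @: S) = S.
Proof.
move=> gS; apply/setP => x; apply/bigcupP/idP => [[_ /imsetP[y yS ->]]|xS].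
  exact/subsetP/porbit_sub_invariant.
by exists (porbit g x); rewrite ?imset_f ?porbit_id.
Qed.

Lemma porbit_imset_cover g P : P \subset porbits g -> porbit g @: cover P = P.
Proof.
move=> sP; apply/setP => C; apply/imsetP/idP => [[x /bigcupP[D DP xD] ->]|CP].
  by rewrite -(porbitsP (subsetP sP _ DP) xD).
have /imsetP[x _ CE] := subsetP sP _ CP.
by exists x => //; apply/bigcupP; exists C; rewrite // CE porbit_id.
Qed.

Lemma card_cover_porbits g P : P \subset porbits g ->
  #|cover P| = (\sum_(C in P) #|C|)%N.
Proof.
have /and3P[_ /trivIsetP tI _] := porbits_partition g.
move=> /subsetP sP; apply/esym/eqP; apply/trivIsetP => A B AP BP.
exact: tI (sP _ AP) (sP _ BP).
Qed.

Lemma porbits_restr_perm g S : g \in 'N(S | 'P) ->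
  porbits (restr_perm S g) = (porbit g @: S) :|: [set [set x] | x in ~: S].
Proof.
move=> gS; have pin x : x \in S -> porbit (restr_perm S g) x = porbit g x.
  move=> xS; have E i : (restr_perm S g ^+ i)%g x = (g ^+ i)%g x.
    by rewrite -(morphX (restr_perm_morphism S)) //= restr_permE ?groupX.
  by apply/setP=> y; apply/porbitP/porbitP => -[i ->]; exists i; rewrite E.
have pout x : x \notin S -> porbit (restr_perm S g) x = [set x].
  move=> xS; have fx : restr_perm S g x = x := out_perm (restr_perm_on S g) xS.
  apply/setP=> y; rewrite inE; apply/porbitP/eqP => [[i ->]|->]; last first.
    by exists 0; rewrite expg0 perm1.
  by rewrite permX; elim: i => //= i ->.
apply/setP => C; rewrite inE; apply/imsetP/orP => [[x _ ->]|].
  have [xS|xS] := boolP (x \in S).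
    by left; rewrite pin ?imset_f.
  by right; rewrite pout ?imset_f // inE.
case=> /imsetP[x xS ->]; exists x => //; first by rewrite pin.
by rewrite pout //; rewrite inE in xS.
Qed.

(** The sign is governed by the number of points minus the number of cycles; the fixed points
    outside [S] add equally to both counts. *)
Lemma restr_perm_sign (R : pzRingType) g S : g \in 'N(S | 'P) ->
  (-1) ^+ (restr_perm S g : bool) = (-1) ^+ (#|S| + #|porbit g @: S|) :> R.
Proof.
move=> gS; rewrite -[RHS]signr_odd; congr (_ ^+ _); congr nat_of_bool.
rewrite /odd_perm porbits_restr_perm // cardsU (card_imset _ set1_inj).
rewrite (_ : _ :&: _ = set0); last first.
  apply/setP => C; rewrite !inE; apply/negP => /andP[/imsetP[x xS ->] /imsetP[y]].
  rewrite inE => /negP yS E; apply: yS.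
  have := porbit_id g x; rewrite E inE => /eqP xy.
  by rewrite -xy.
rewrite cards0 subn0 -(cardsC S) !oddD; by do 3!case: (odd _).
Qed.

(* Invariant subsets are unions of cycles: expand the product over the cycles. *)
Lemma sum_invariant_sets (R : comNzRingType) (u v : R) g :
  \sum_(S : {set T} | g \in 'N(S | 'P))
     (-1) ^+ (restr_perm S g : bool) * (v ^+ #|S| * u ^+ (#|T| - #|S|)) =
  \prod_(C in porbits g) (u ^+ #|C| - (- v) ^+ #|C|).
Proof.
rewrite (reindex_onto cover (imset (porbit g) \o mem)) /=; last first.
  by move=> S; apply: cover_porbit_imset.
have condE P : (g \in 'N(cover P | 'P)) && (porbit g @: cover P == P) = (P \subset porbits g).
  apply/andP/idP => [[_ /eqP <-]|sP]; last first.
    by rewrite cover_porbits_invariant // porbit_imset_cover.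
  by apply/subsetP => C /imsetP[x _ ->]; apply: imset_f.
rewrite (eq_bigl _ _ condE) [RHS]big_mkcond /=.
(* [F] and [G] are the two terms of a factor, extended by 0 and 1 off the cycles: [bigA_distr]
   ranges over all sets of sets, and the zeros leave only the [P] made of cycles. *)
pose F C : R := if C \in porbits g then - (- v) ^+ #|C| else 0.
pose G C : R := if C \in porbits g then u ^+ #|C| else 1.
rewrite (eq_bigr (fun C => F C + G C)); last first.
  by move=> C _; rewrite /F /G; case: ifP => _; rewrite ?add0r // addrC.
rewrite bigA_distr [RHS](bigID (fun P : {set {set T}} => P \subset porbits g)) /=.
rewrite [X in _ + X]big1 ?addr0; last first.
  move=> P /subsetPn[C CP CN]; rewrite (bigD1 C) //= CP /F (negPf CN) mul0r //.
apply: eq_bigr => P sP; rewrite restr_perm_sign ?cover_porbits_invariant //.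
rewrite porbit_imset_cover // [RHS](bigID (mem P)) /=.
have -> : \prod_(C in P) (if C \in P then F C else G C) =
    \prod_(C in P) (- 1 * (- 1 * v) ^+ #|C|).
  by apply: eq_bigr => C CP; rewrite CP /F (subsetP sP _ CP) !mulN1r.
have -> : \prod_(C | C \notin P) (if C \in P then F C else G C) =
    u ^+ (#|T| - #|cover P|).
  transitivity (\prod_(C | (C \notin P) && (C \in porbits g)) u ^+ #|C|).
    by rewrite big_mkcondr; apply: eq_bigr => C /negPf->.
  rewrite prodrXr; congr (_ ^+ _).
  have := card_cover_porbits (subxx (porbits g)).
  rewrite (cover_partition (porbits_partition g)) cardsT => ->.
  rewrite [X in (X - _)%N](bigID (mem P)) /= (card_cover_porbits sP) //.
    have -> : (\sum_(C in porbits g | C \in P) #|C| = \sum_(C in P) #|C|)%N.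
    apply: eq_bigl => C.
    by rewrite andbC; case CP: (C \in P); rewrite //= (subsetP sP).
  by rewrite addKn; apply: eq_bigl => C; rewrite andbC.
rewrite big_split /= prodr_const prodrXr -(card_cover_porbits sP).
by rewrite exprMn exprD (mulrC ((-1) ^+ #|cover P|)) !mulrA.
Qed.

End InvariantSubsets.

(** * Stabilizers of sets and their sign characters *)

Section Stabilizers.
Variable T : finType.
Implicit Types (g h : {perm T}) (S U : {set T}).

Lemma astabs_imset g S : (g \in 'N(S | 'P)) = (g @: S == S).
Proof.
apply/astabsP/eqP => [gS | gS x]; last first.
  by rewrite /= apermE -[in LHS]gS (mem_imset _ _ perm_inj).
apply/setP => y; rewrite -[y](permKV g) (mem_imset _ _ perm_inj).
by have := gS (g^-1 y)%g; rewrite /= apermE permKV.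
Qed.

Lemma imset_permM g h S : (g * h)%g @: S = h @: (g @: S).
Proof. by rewrite -imset_comp; apply: eq_imset => x /=; rewrite permM. Qed.

Lemma imset_permV g S U : (g^-1%g @: S == U) = (S == g @: U).
Proof.
apply/eqP/eqP => [<-|->].
  by rewrite -imset_permM mulVg (eq_imset _ (@perm1 T)) imset_id.
by rewrite -imset_permM mulgV (eq_imset _ (@perm1 T)) imset_id.
Qed.

Lemma astabs_conj h g S : (g ^ h \in 'N(h @: S | 'P))%g = (g \in 'N(S | 'P)).
Proof.
rewrite !astabs_imset conjgE imset_permM imset_permM.
rewrite -(imset_permM h) mulgV (eq_imset _ (@perm1 T)) imset_id.
by rewrite (inj_eq (imset_inj perm_inj)).
Qed.

Lemma odd_restr_perm_conj h g S : g \in 'N(S | 'P) ->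
  restr_perm (h @: S) (g ^ h)%g = restr_perm S g :> bool.
Proof.
move=> gS; have -> : restr_perm (h @: S) (g ^ h)%g = (restr_perm S g ^ h)%g.
  apply/permP => x; rewrite -[x](permKV h) permJ; set y := (h^-1)%g x.
  have [yS|yS] := boolP (y \in S).
    by rewrite !restr_permE ?astabs_conj ?imset_f // permJ.
  rewrite (out_perm (restr_perm_on _ _)) ?(mem_imset _ _ perm_inj) //.
  by rewrite (out_perm (restr_perm_on _ _)).
by rewrite odd_permJ.
Qed.

(** The permutations taking one pair to the other form the right coset by [h] of the stabilizer of
    the first pair. *)
Lemma card_transporter S U S' U' h : h @: S = S' -> h @: U = U' ->
  #|[set g : {perm T} | (g @: S == S') && (g @: U == U')]| =
  #|'N(S | 'P) :&: 'N(U | 'P)|.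
Proof.
move=> hS hU; rewrite -(card_rcoset _ h); apply: eq_card => g.
rewrite mem_rcoset in_setI !astabs_imset !imset_permM inE -hS -hU.
by rewrite !imset_permV.
Qed.

Lemma tperm_astabs a b S : (a \in S) = (b \in S) -> tperm a b \in 'N(S | 'P).
Proof.
by move=> ab; apply/astabsP => x /=; rewrite apermE; case: tpermP => // ->.
Qed.

Lemma restr_tperm_in a b S :
  a \in S -> b \in S -> restr_perm S (tperm a b) = tperm a b.
Proof.
move=> aS bS; apply/permP => x; have [xS|xS] := boolP (x \in S).
  by rewrite restr_permE // tperm_astabs ?aS.
rewrite (out_perm (restr_perm_on _ _)) // tpermD //.
  by apply: contraNneq xS => <-.
by apply: contraNneq xS => <-.
Qed.

Lemma restr_tperm_out a b S :
  a \notin S -> b \notin S -> restr_perm S (tperm a b) = 1%g.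
Proof.
move=> aS bS; apply/permP => x; rewrite perm1; have [xS|xS] := boolP (x \in S).
  rewrite restr_permE ?tperm_astabs ?(negPf aS) ?(negPf bS) // tpermD //.
    by apply: contraNneq aS => ->.
  by apply: contraNneq bS => ->.
by rewrite (out_perm (restr_perm_on _ _)).
Qed.

Lemma restr_perm_setI g S U : (#|S :\: U| <= 1)%N ->
  g \in 'N(S | 'P) -> g \in 'N(U | 'P) -> restr_perm S g = restr_perm (S :&: U) g.
Proof.
move=> SU gS gU; have gSU : g \in 'N(S :&: U | 'P).
  apply/astabsP => x; rewrite !inE.
  by have /astabsP-> := gS; have /astabsP-> := gU.
apply/permP => x; have [xSU|] := boolP (x \in S :&: U).
  by rewrite !restr_permE //; case/setIP: xSU.
move=> xSU; rewrite [RHS](out_perm (restr_perm_on _ _)) //.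
have [xS|xS] := boolP (x \in S); last by rewrite (out_perm (restr_perm_on _ _)).
rewrite restr_permE //; rewrite inE xS /= in xSU.
apply/eqP; have /card_le1P/(_ x) := SU; rewrite inE xS xSU => /(_ isT)/(_ (g x)).
rewrite !inE => <-.
have /astabsP/(_ x)/= := gS; have /astabsP/(_ x)/= := gU.
by rewrite !apermE => -> ->; rewrite xS xSU.
Qed.

Definition res_sign S g : algC := (-1) ^+ (restr_perm S g : bool).

Lemma res_signM S : {in 'N(S | 'P) &, {morph res_sign S : g h / (g * h)%g >-> g * h}}.
Proof.
move=> g h gS hS; rewrite /res_sign (morphM (restr_perm_morphism S)) //=.
by rewrite odd_permM signr_addb.
Qed.

(* A transposition of two points of [S :\: U] flips the sign on [S] only. *)
Lemma sum_res_sign_eq0 S U : (1 < #|S :\: U|)%N ->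
  \sum_(g in 'N(S | 'P) :&: 'N(U | 'P)) res_sign S g * res_sign U g = 0.
Proof.
case/card_gt1P => a [b [/setDP[aS aU] /setDP[bS bU] ab]].
have tS : tperm a b \in 'N(S | 'P) by rewrite tperm_astabs ?aS.
have tU : tperm a b \in 'N(U | 'P) by rewrite tperm_astabs ?(negPf aU) ?(negPf bU).
have tSU := introT setIP (conj tS tU).
set s := (X in X = 0); have: s = - s; last first.
  by move/eqP; rewrite -addr_eq0 -mulr2n mulrn_eq0 => /eqP.
rewrite {1}/s (reindex_inj (mulgI (tperm a b))) /= -sumrN.
apply: eq_big => g; first by rewrite groupMl.
rewrite groupMl // => /setIP[gS gU]; rewrite !res_signM //.
rewrite /res_sign restr_tperm_in // restr_tperm_out // odd_tperm ab odd_perm1.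
by rewrite expr0 expr1 mul1r mulN1r mulNr.
Qed.

(** If both differences have at most one point, both signs equal the sign on [S :&: U] and every
    term is 1; otherwise [sum_res_sign_eq0] applies, possibly with [S] and [U] exchanged. *)
Lemma sum_res_sign S U : \sum_(g in 'N(S | 'P) :&: 'N(U | 'P)) res_sign S g * res_sign U g =
  if (#|S :\: U| <= 1)%N && (#|U :\: S| <= 1)%N
  then #|'N(S | 'P) :&: 'N(U | 'P)|%:R else 0.
Proof.
case: leqP => [SU|/sum_res_sign_eq0//]; case: leqP => /= [US|US]; last first.
  rewrite setIC; under eq_bigr do rewrite mulrC.
  exact: sum_res_sign_eq0.
rewrite -sumr_const; apply: eq_bigr => g /setIP[gS gU]; rewrite /res_sign.
rewrite (restr_perm_setI SU) // (restr_perm_setI US) // setIC.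
by rewrite -signr_addb addbb.
Qed.

End Stabilizers.

(** * Transitivity of the symmetric group on pairs of subsets *)

Lemma perm_coloring n (C : finType) (f f' : 'I_n -> C) :
  (forall c, #|[pred i | f i == c]| = #|[pred i | f' i == c]|) ->
  exists p : 'S_n, forall i, f (p i) = f' i.
Proof.
move=> eqc; have /tuple_permP[p pE] : perm_eq [tuple f' i | i < n] [tuple f i | i < n].
  apply/allP => c _ /=; rewrite !count_map; apply/eqP.
  have ct (e : 'I_n -> C) : count (preim e (pred1 c)) (enum 'I_n) = #|[pred i | e i == c]|.
    by rewrite -sum1_card -sum1_count big_enum_cond.
  rewrite -enumT; exact: (etrans (ct f') (etrans (esym (eqc c)) (esym (ct f)))).
exists p => i; have /(congr1 (fun s => nth (f' i) s i)) := pE.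
by rewrite -!tnth_nth !tnth_mktuple.
Qed.

(** Color each point by its membership in the two sets: the three cardinals determine the sizes of
    the four color classes. *)
Lemma perm_two_sets n (S U S' U' : {set 'I_n}) :
  #|S| = #|S'| -> #|U| = #|U'| -> #|S :&: U| = #|S' :&: U'| ->
  exists p : 'S_n, p @: S = S' /\ p @: U = U'.
Proof.
move=> SS UU SU.
have [|p pE] := @perm_coloring n (bool * bool)%type
    (fun i => (i \in S', i \in U')) (fun i => (i \in S, i \in U)).
  have e (X Y : {set 'I_n}) : [/\
      #|[pred i | (i \in X, i \in Y) == (true, true)]| = #|X :&: Y|,
      #|[pred i | (i \in X, i \in Y) == (true, false)]| = (#|X| - #|X :&: Y|)%N,
      #|[pred i | (i \in X, i \in Y) == (false, true)]| = (#|Y| - #|X :&: Y|)%N &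
      #|[pred i | (i \in X, i \in Y) == (false, false)]| = (n - (#|X| + #|Y| - #|X :&: Y|))%N].
    have cC : #|~: (X :|: Y)| = (n - #|X :|: Y|)%N.
      by rewrite cardsCs setCK card_ord.
    rewrite -cardsU -cC -cardsD {2}setIC -cardsD.
    by split; apply: eq_card => i; rewrite !inE xpair_eqE; do 2!case: (_ \in _).
  have [a1 a2 a3 a4] := e S U; have [b1 b2 b3 b4] := e S' U'.
  by case=> [[|] [|]]; rewrite ?a1 ?a2 ?a3 ?a4 ?b1 ?b2 ?b3 ?b4 ?SS ?UU ?SU.
exists p; split; apply/setP => x; rewrite -[x](permKV p) (mem_imset _ _ perm_inj).
  by case: (pE (p^-1%g x)).
by case: (pE (p^-1%g x)).
Qed.

(** * Hook characters of the symmetric group *)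

Lemma card_ord_lt n k : (k <= n)%N -> #|[set i : 'I_n | (i < k)%N]| = k.
Proof.
move=> le_kn; have -> : [set i : 'I_n | (i < k)%N] = widen_ord le_kn @: setT.
  apply/setP => i; rewrite inE; apply/idP/imsetP => [lt_ik|[j _ ->]]; last exact: (ltn_ord j).
  by exists (Ordinal lt_ik) => //; apply: val_inj.
rewrite card_imset ?cardsT ?card_ord // => i j /(congr1 val) /= ij.
exact: val_inj.
Qed.

Lemma two_sets_exist n k l m : (m <= k)%N -> (m <= l)%N -> (k + l - m <= n)%N ->
  exists A : {set 'I_n} * {set 'I_n},
    [/\ #|A.1| = k, #|A.2| = l & #|A.1 :&: A.2| = m].
Proof.
move=> mk ml kln; pose I j := [set i : 'I_n | (i < j)%N].
have sI a b : (a <= b)%N -> I a \subset I b.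
  by move=> ab; apply/subsetP => i; rewrite !inE => /leq_trans->.
have cI j : (j <= n)%N -> #|I j| = j by apply: card_ord_lt.
have [kle kml] : (k <= k + l - m)%N /\ (k - m <= k)%N by split; lia.
have kmn : (k - m <= n)%N by lia.
(* The intervals [[0, k)] and [[k - m, k + l - m)] overlap in exactly [m] points. *)
exists (I k, I (k + l - m)%N :\: I (k - m)%N) => /=; split.
- by rewrite cI // (leq_trans kle).
- by rewrite cardsD (setIidPr (sI _ _ (leq_trans kml kle))) !cI //; lia.
rewrite setIDA (setIidPl (sI _ _ kle)) cardsD (setIidPr (sI _ _ kml)).
by rewrite !cI // ?(leq_trans kle) // subKn.
Qed.

(** Orbit-stabilizer: the pairs with these cardinals, if any, form a single orbit, so their
    stabilizer orders add up to [n!]. *)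
Lemma sum_card_pair_stabilizers n k l m :
  (\sum_(A : {set 'I_n} * {set 'I_n} |
      [&& #|A.1| == k, #|A.2| == l & #|A.1 :&: A.2| == m])
     #|('N(A.1 | 'P) :&: 'N(A.2 | 'P))%g|)%N =
  if [&& m <= k, m <= l & k + l - m <= n]%N then n`! else 0%N.
Proof.
case: ifPn => [/and3P[mk ml kln]|H]; last first.
  rewrite big_pred0 // => A; apply: contraNF H => /and3P[/eqP<- /eqP<- /eqP<-].
  rewrite subset_leq_card ?subsetIl // subset_leq_card ?subsetIr //= -cardsU.
  by rewrite -[X in (_ <= X)%N]card_ord max_card.
have [[S U] /= [Sk Ul SUm]] := two_sets_exist mk ml kln.
rewrite -card_Sn -cardsT -sum1_card.
rewrite (partition_big (fun g : 'S_n => (g^-1%g @: S, g^-1%g @: U))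
  (fun A => [&& #|A.1| == k, #|A.2| == l & #|A.1 :&: A.2| == m])); last first.
  move=> g _ /=; rewrite -imsetI; last by move=> x y _ _; apply: perm_inj.
  by rewrite !(card_imset _ (@perm_inj _ _)) Sk Ul SUm !eqxx.
apply: eq_bigr => -[S' U'] /= /and3P[/eqP S'k /eqP U'l /eqP SUm'].
have [|||h [hS hU]] := @perm_two_sets n S' U' S U; rewrite ?Sk ?Ul ?SUm //.
rewrite -(card_transporter hS hU) -sum1_card; apply: eq_bigl => g.
by rewrite !inE xpair_eqE !imset_permV ![_ @: _ == _]eq_sym.
Qed.

(** Counts the overlaps [m] that contribute to the inner product of two exterior powers. For [k = l]
    these are [m = k] and, when a point can be exchanged for one outside, [m = k - 1]; for
    consecutive sizes the smaller set lies in the larger. *)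
Lemma sum_overlaps n k l : (k <= n)%N -> (l <= n)%N ->
  (\sum_(m < n.+1) [&& k - m <= 1, l - m <= 1, m <= k, m <= l & k + l - m <= n] =
   (k == l) + (k == l.+1) + (l == k.+1) + [&& k == l, 0 < k & k < n])%N.
Proof.
move=> le_kn le_ln.
have sum1 (j : nat) (b : bool) : (\sum_(m < n.+1) (b && (m == j :> nat)) = b && (j <= n))%N.
  case: b => /=; last by rewrite big1.
  case: leqP => [jn|nj]; last first.
    by rewrite big1 // => m _; rewrite ltn_eqF // (leq_trans (ltn_ord m)).
  rewrite (bigD1 (inord j)) //= inordK // eqxx big1 // => m.
  by rewrite -val_eqE /= inordK // => /negPf->.
have pw (m : nat) :
    ([&& k - m <= 1, l - m <= 1, m <= k, m <= l & k + l - m <= n] =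
     [|| (k == l) && (m == k), (k == l.+1) && (m == l), (l == k.+1) && (m == k)
       | [&& k == l, 0 < k & k < n] && (m == k.-1)])%N.
  apply/and5P/or4P => [[km lm mk ml kln]|].
    have [kl|kl|kl] := ssrnat.ltngtP k l.
    - apply: Or43; have -> : m = k by lia.
      by rewrite eqxx andbT; apply/eqP; lia.
    - apply: Or42; have -> : m = l by lia.
      by rewrite eqxx andbT; apply/eqP; lia.
    have [mk'|mk'] := eqVneq m k; first by apply: Or41.
    have lt_mk : (m < k)%N by rewrite ltn_neqAle mk' mk.
    have Ek : k = m.+1 by lia.
    have kn : (k < n)%N by lia.
    by apply: Or44; rewrite kn Ek /= eqxx.
  case=> /andP[].
  - by move=> /eqP kl /eqP->; split; lia.
  - by move=> /eqP kl /eqP->; split; lia.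
  - by move=> /eqP kl /eqP->; split; lia.
  by move=> /and3P[/eqP kl k0 kn] /eqP->; split; lia.
under eq_bigr => m _ do rewrite pw.
case: (ssrnat.ltngtP k l) => [kl|kl|kl] /=.
- rewrite (ltn_eqF (leqW kl)) addn0; under eq_bigr do rewrite /= orbF.
  by rewrite sum1 le_kn andbT.
- rewrite (ltn_eqF (leqW kl)) !addn0; under eq_bigr do rewrite /= orbF.
  by rewrite sum1 le_ln andbT.
rewrite kl !(ltn_eqF (ltnSn l)) !addn0 /=.
rewrite (eq_bigr (fun m : 'I_n.+1 =>
    (true && (m == l :> nat)) + ((0 < l < n) && (m == l.-1 :> nat)))%N).
  by rewrite big_split !sum1 /= le_ln (leq_trans (leq_pred l) le_ln) andbT.
move=> m _; case: (0 < l < n)%N / andP => [[l0 _]|] /=; last by rewrite orbF addn0.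
by case: eqVneq => [->|] //=; rewrite gtn_eqF ?prednK.
Qed.

Section HookCharacters.
Variable n : nat.
Implicit Types (g h : 'S_n) (S U : {set 'I_n}).

Definition res_sign_mx S g : 'M[algC]_1 := (res_sign S g)%:M.

Fact res_sign_mx_repr S : mx_repr 'N(S | 'P) (res_sign_mx S).
Proof.
split=> [|g h gS hS]; last by rewrite /res_sign_mx res_signM // scalar_mxM.
by rewrite /res_sign_mx /res_sign (morph1 (restr_perm_morphism S)) /= odd_perm1.
Qed.

Definition sgn_cfun S := cfRepr (MxRepresentation (res_sign_mx_repr S)).

Lemma sgn_cfunE S g : sgn_cfun S g = if g \in 'N(S | 'P) then res_sign S g else 0.
Proof. by rewrite cfunE /= mxtrace_scalar mulrb; case: ifP. Qed.

(* The character of the [k]-th exterior power of the permutation representation;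
   meaningful for [k <= n] only. *)
Definition ext_char k : 'CF([set: 'S_n]) :=
  'Ind[[set: 'S_n]] (sgn_cfun [set i : 'I_n | (i < k)%N]).

(** The cosets of the stabilizer of the initial segment correspond to the [k]-subsets, and the terms
    of the induction formula depend only on the coset. *)
Lemma ext_charE k g : (k <= n)%N ->
  ext_char k g = \sum_(S : {set 'I_n} | (#|S| == k) && (g \in 'N(S | 'P))) res_sign S g.
Proof.
move=> le_kn; set S0 := [set i : 'I_n | (i < k)%N].
have S0k : #|S0| = k by apply: card_ord_lt.
rewrite /ext_char cfIndE ?subsetT //.
apply: (canLR (mulKf _)); first by rewrite pnatr_eq0 -lt0n cardG_gt0.
pose F S := if g \in 'N(S | 'P) then res_sign S g else 0.
have FE y : sgn_cfun S0 (g ^ y)%g = F (y^-1%g @: S0).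
  rewrite sgn_cfunE /F; have S0E : S0 = y @: (y^-1%g @: S0).
    by apply/eqP; rewrite -imset_permV.
  rewrite {1}S0E astabs_conj; case: ifP => // gS.
  by rewrite {1}S0E /res_sign odd_restr_perm_conj.
rewrite (eq_bigr _ (fun y _ => FE y)) (reindex_inj invg_inj) /=.
under eq_bigr do rewrite invgK.
rewrite (partition_big (fun y : 'S_n => y @: S0) (fun S => #|S| == k)) /=; last first.
  by move=> y _; rewrite (card_imset _ (@perm_inj _ _)) S0k.
rewrite big_mkcondr mulr_sumr; apply: eq_bigr => S /eqP Sk.
rewrite (eq_bigr (fun=> F S)); last by move=> y /andP[_ /eqP->].
(* The empty set as second component reduces this count to [card_transporter] for pairs. *)
have [|||h [hS hU]] := @perm_two_sets n S0 set0 S set0; rewrite ?setI0 ?S0k //.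
rewrite sumr_const mulr_natl -/S0 -/(F S); congr (_ *+ _).
have <- : 'N(S0 | 'P) :&: 'N(set0 | 'P) = 'N(S0 | 'P).
  by apply/setIidPl/subsetP => y _; rewrite astabs_imset imset0.
rewrite -(card_transporter hS hU); apply: eq_card => y.
by rewrite [LHS]/in_mem /= !inE imset0 eqxx andbT.
Qed.

(** After exchanging sums, each pair of sets contributes the order of its stabilizer or 0, depending
    only on the overlap [m]; each admissible [m] then contributes [n!], which the normalization
    cancels. *)
Lemma cfdot_ext_char k l : (k <= n)%N -> (l <= n)%N ->
  '[ext_char k, ext_char l] = ((k == l) + (k == l.+1) + (l == k.+1)
     + [&& k == l, 0 < k & k < n])%N%:R.
Proof.
move=> le_kn le_ln; rewrite cfdotE.
rewrite (eq_bigr (fun g => \sum_(A : {set 'I_n} * {set 'I_n} |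
    ((#|A.1| == k) && (#|A.2| == l)) && (g \in 'N(A.1 | 'P) :&: 'N(A.2 | 'P)))
    res_sign A.1 g * res_sign A.2 g)); last first.
  move=> g _; rewrite !ext_charE // rmorph_sum big_distrlr pair_big /=.
  apply: eq_big => [A|A _]; last by rewrite [_^*]rmorph_sign.
  by rewrite (in_setI _ 'N(A.1 | 'P)) andbACA.
rewrite (exchange_big_dep (fun A : {set 'I_n} * {set 'I_n} =>
   (#|A.1| == k) && (#|A.2| == l))) /=; last by move=> g A _ /andP[].
pose c m := [&& k - m <= 1, l - m <= 1, m <= k, m <= l & k + l - m <= n]%N.
transitivity (\sum_(m < n.+1) (c m)%:R : algC).
  apply: (canLR (mulKf _)); first by rewrite pnatr_eq0 -lt0n cardG_gt0.
  rewrite (partition_big (fun A : {set 'I_n} * {set 'I_n} =>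
    inord #|A.1 :&: A.2| : 'I_n.+1) predT) //=.
  rewrite mulr_sumr; apply: eq_bigr => m _.
  rewrite (eq_bigl (fun A : {set 'I_n} * {set 'I_n} =>
     [&& #|A.1| == k, #|A.2| == l & #|A.1 :&: A.2| == m])); last first.
    move=> A; rewrite -andbA; congr [&& _, _ & _].
    rewrite -val_eqE /= inordK // ltnS -[X in (_ <= X)%N]card_ord max_card //.
  have good (A : {set 'I_n} * {set 'I_n}) :
      [&& #|A.1| == k, #|A.2| == l & #|A.1 :&: A.2| == m] ->
      \sum_(g in 'N(A.1 | 'P) :&: 'N(A.2 | 'P)) res_sign A.1 g * res_sign A.2 g =
      (if (k - m <= 1)%N && (l - m <= 1)%N
       then #|'N(A.1 | 'P) :&: 'N(A.2 | 'P)|%:R else 0).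
    move=> /and3P[/eqP Ak /eqP Al /eqP Am].
    by rewrite sum_res_sign !cardsD Ak Al Am setIC Am.
  transitivity (\sum_(A : {set 'I_n} * {set 'I_n} |
      [&& #|A.1| == k, #|A.2| == l & #|A.1 :&: A.2| == m])
      (if (k - m <= 1)%N && (l - m <= 1)%N
       then #|'N(A.1 | 'P) :&: 'N(A.2 | 'P)|%:R else 0 : algC)).
    apply: eq_bigr => A HA; rewrite -(good A HA); apply: eq_bigl => g.
    by case/and3P: HA => -> -> _; rewrite in_setT.
  rewrite cardsT card_Sn /c andbA.
  case: ((k - m <= 1)%N && (l - m <= 1)%N) => /=; last by rewrite mulr0 big1.
  by rewrite -natr_sum sum_card_pair_stabilizers; case: ifP; rewrite ?mulr1 ?mulr0.
by rewrite -natr_sum sum_overlaps.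
Qed.
End HookCharacters.

(** Generalized orthogonality for irreducible characters up to sign: both signs are absorbed by
    ['[phi, psi]], and that of [phi] cancels in [phi y / phi 1]. *)
Lemma dirr_convolution (gT : finGroupType) (G : {group gT}) (phi psi : 'CF(G)) y :
  phi \in dirr G -> psi \in dirr G ->
  \sum_(x in G) phi (x * y)%g * psi x^-1%g = #|G|%:R * ('[phi, psi] * (phi y / phi 1%g)).
Proof.
case/dirrP=> b [i ->] /dirrP[c [j ->]].
apply: (canRL (mulVKf _)); first by rewrite pnatr_eq0 -lt0n cardG_gt0.
rewrite cfdotZl cfdotZr cfdot_irr rmorph_sign !cfunE.
under eq_bigr do rewrite !cfunE mulrACA.
rewrite -mulr_sumr mulrCA generalized_orthogonality_relation -mulf_div divff ?signr_eq0 //.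
by rewrite mul1r !mulrA.
Qed.

(** * Orthonormality of the hooks, their sums, and the count of pairs of n-cycles *)

Section Hooks.
Variable n : nat.
Hypothesis n_gt0 : (0 < n)%N.
Implicit Types (g h x y : 'S_n) (S U : {set 'I_n}).
Local Notation ext_char := (ext_char n).

(* Exterior powers satisfy [ext k.+1 = hook k.+1 + hook k]; meaningful for [k < n]
   only. *)
Fixpoint hook_char k : 'CF([set: 'S_n]) :=
  if k is k'.+1 then ext_char k - hook_char k' else ext_char 0.

Lemma cfdot_hook_ext k l : (k < n)%N -> (l <= n)%N ->
  '[hook_char k, ext_char l] = ((l == k) + (l == k.+1))%N%:R.
Proof.
move=> + ln; elim: k => [|k IH] kn /=.
  by rewrite cfdot_ext_char //; congr _%:R; lia.
rewrite cfdotBl (cfdot_ext_char (ltnW kn) ln) (IH (ltnW kn)).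
apply/eqP; rewrite subr_eq -natrD; apply/eqP; congr _%:R; lia.
Qed.

Lemma cfdot_hook_char k l : (k < n)%N -> (l < n)%N ->
  '[hook_char k, hook_char l] = (k == l)%:R.
Proof.
move=> kn; elim: l => [|l IH] ln /=.
  by rewrite cfdot_hook_ext //; congr _%:R; lia.
rewrite cfdotBr (cfdot_hook_ext kn (ltnW ln)) (IH (ltnW ln)).
apply/eqP; rewrite subr_eq -natrD; apply/eqP; congr _%:R; lia.
Qed.

(** A generalized character of norm 1 is irreducible up to sign, which suffices for
    [dirr_convolution]. *)
Lemma hook_char_dirr k : (k < n)%N -> hook_char k \in dirr [set: 'S_n].
Proof.
move=> kn; apply: dirr_norm1; last by rewrite cfdot_hook_char ?eqxx.
have Zext j : ext_char j \in 'Z[irr [set: 'S_n]].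
  by rewrite char_vchar // cfInd_char // cfRepr_char.
by elim: k {kn} => [|k IH] /=; rewrite ?rpredB.
Qed.

(** Brings weighted sums of exterior powers into the form evaluated by [sum_invariant_sets]; [f]
    allows weights in [algC] or in polynomials. *)
Lemma sum_ext_char (R : comNzRingType) (f : {rmorphism algC -> R}) (F : nat -> R) g :
  \sum_(k < n.+1) f (ext_char k g) * F k =
  \sum_(S : {set 'I_n} | g \in 'N(S | 'P)) (-1) ^+ (restr_perm S g : bool) * F #|S|.
Proof.
rewrite [RHS](partition_big (fun S => inord #|S| : 'I_n.+1) predT) //=.
apply: eq_bigr => k _; rewrite ext_charE ?leq_ord // rmorph_sum mulr_suml.
apply: eq_big => [S|S /andP[/eqP-> _]]; last by rewrite /res_sign rmorph_sign.
rewrite andbC; congr (_ && _); rewrite -val_eqE /= inordK //.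
by rewrite ltnS -[X in (_ <= X)%N]card_ord max_card.
Qed.

Lemma ext_char1 k : (k <= n)%N -> ext_char k 1%g = 'C(n, k)%:R.
Proof.
move=> kn; rewrite ext_charE // -[n in 'C(n, _)]card_ord -card_draws -sum1_card natr_sum.
apply: eq_big => [S|S _]; first by rewrite inE group1 andbT.
by rewrite /res_sign (morph1 (restr_perm_morphism S)) /= odd_perm1.
Qed.

Lemma hook_char1 k : (k < n)%N -> hook_char k 1%g = 'C(n.-1, k)%:R.
Proof.
elim: k => [|k IH] kn /=; first by rewrite ext_char1 // !bin0.
rewrite !cfunE ext_char1 1?ltnW // (IH (ltnW kn)) -[n in 'C(n, _)](prednK n_gt0) binS.
by rewrite natrD addrK.
Qed.

Lemma porbits_neq0 g : (0 < #|porbits g|)%N.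
Proof. by apply/card_gt0P; exists (porbit g (Ordinal n_gt0)); apply: imset_f. Qed.

Lemma alternating_hook k g :
  (-1) ^+ k * hook_char k g = \sum_(j < k.+1) (-1) ^+ j * ext_char j g.
Proof.
elim: k => [|k IH]; first by rewrite big_ord1.
rewrite big_ord_recr /= -IH !cfunE exprS; ring.
Qed.

(** Up to sign this is the full alternating sum of exterior powers, the product over cycles at
    [u = 1], [v = -1], where each factor is 0. *)
Lemma hook_char_n g : hook_char n g = 0.
Proof.
apply: (mulfI (negbT (signr_eq0 algC n))); rewrite mulr0 alternating_hook.
rewrite (eq_bigr (fun k : 'I_n.+1 => idfun (ext_char k g) * (-1) ^+ k)); last first.
  by move=> k _; rewrite mulrC.
rewrite (sum_ext_char idfun (fun k => (-1) ^+ k)).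
transitivity (\prod_(C in porbits g) ((1 : algC) ^+ #|C| - (- -1) ^+ #|C|)).
  by rewrite -sum_invariant_sets; apply: eq_bigr => S _; rewrite expr1n mulr1.
have /card_gt0P[C CP] := porbits_neq0 g.
by rewrite (bigD1 C) //= opprK !expr1n subrr mul0r.
Qed.

(** The [k]-th exterior power enters the hooks of index [k] to [m - 1], hence [m - k] times. *)
Lemma alternating_sum_hook m g : \sum_(k < m) (-1) ^+ k * hook_char k g =
  \sum_(k < m) ext_char k g * ((-1) ^+ k * (m - k)%:R).
Proof.
elim: m => [|m IH]; first by rewrite !big_ord0.
rewrite big_ord_recr /= IH alternating_hook !big_ord_recr /= subSnn mulr1 addrA.
rewrite -big_split /=; congr (_ + _); last exact: mulrC.
by apply: eq_bigr => k _; rewrite subSn 1?ltnW // -natr1; ring.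
Qed.

(** The weight [n - k] comes from differentiating [u^(n - k)] at [u = 1]. With [v = -1] the sum is
    the derivative at 1 of the product of the [u^|C| - 1], which is 0 as soon as two factors vanish
    there. *)
Lemma is_n_cycle_hook g :
  \sum_(k < n) (-1) ^+ k * hook_char k g = n%:R * (is_n_cycle g)%:R.
Proof.
rewrite alternating_sum_hook.
(* The added term [k = n] has weight [n - n = 0]. *)
have -> : \sum_(k < n) ext_char k g * ((-1) ^+ k * (n - k)%:R) =
          \sum_(k < n.+1) ext_char k g * ((-1) ^+ k * (n - k)%:R).
  by rewrite big_ord_recr /= subnn !mulr0 addr0.
rewrite (sum_ext_char idfun (fun k => (-1) ^+ k * (n - k)%:R)).
transitivity ((\prod_(C in porbits g) ('X^#|C| - (- -1) ^+ #|C| : {poly algC}))^`().[1]).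
  rewrite -sum_invariant_sets (linear_sum (@deriv algC)) horner_sum.
  apply: eq_bigr => S _ /=; rewrite card_ord [in RHS]mulrA -exprD -(rmorph_sign polyC).
  by rewrite mul_polyC derivZ derivXn hornerZ hornerMn hornerXn expr1n exprD mulrA.
rewrite opprK; under eq_bigr do rewrite expr1n.
have h1 (D : {set 'I_n}) : ('X^#|D| - 1 : {poly algC}).[1] = 0.
  by rewrite !hornerE expr1n subrr.
have /card_gt0P[C CP] := porbits_neq0 g; rewrite (bigD1 C) //= derivM.
rewrite derivB derivXn derivC subr0 hornerD !hornerM h1 mul0r addr0.
rewrite hornerMn hornerXn expr1n.
have [P1|] := eqVneq #|porbits g| 1%N.
  have /cards1P[D DE] : #|porbits g| == 1%N by rewrite P1.
  have CD : C = D by apply/set1P; rewrite -DE.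
  have Cn : #|C| = n.
    have := card_cover_porbits (subxx (porbits g)).
    rewrite (cover_partition (porbits_partition g)) cardsT card_ord.
    by rewrite DE big_set1 CD => <-.
  rewrite big1 => [|E /andP[EP EC]]; last by rewrite DE CD inE in EP EC; rewrite EP in EC.
  rewrite hornerC mulr1 Cn /is_n_cycle /has_rect_cycle_type P1 /=.
  have -> : [forall E in porbits g, #|E| == n].
    by apply/forall_inP => E; rewrite DE inE -CD => /eqP->; rewrite Cn.
  by rewrite mulr1.
move=> P1; rewrite /is_n_cycle /has_rect_cycle_type (negPf P1) mulr0.
have /card_gt1P[D [E [DP EP DE]]] : (1 < #|porbits g|)%N.
  by rewrite ltn_neqAle eq_sym P1 porbits_neq0.
have [F FP FC] : exists2 F, F \in porbits g & F != C.
  by have [DC|] := eqVneq D C; [exists E; rewrite // -DC eq_sym | exists D].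
by rewrite (bigD1 F) ?FP //= hornerM h1 mul0r mulr0.
Qed.

(** Summation by parts: each exterior power is the sum of two consecutive hooks. *)
Lemma sum_ext_char_hook (B : nat -> {poly algC}) m g :
  \sum_(k < m.+1) ext_char k g *: B k =
  hook_char m g *: B m + \sum_(k < m) hook_char k g *: (B k + B k.+1).
Proof.
elim: m => [|m IH]; first by rewrite big_ord0 big_ord1 addr0.
rewrite big_ord_recr IH big_ord_recr /= !cfunE scalerBl scalerDr.
move: (_ *: _) (\sum_(k < m) _) (_ *: _) (_ *: _) => a s c d; ring.
Qed.

(** Expand the product with [u = 1 - 'X], [v = 'X] and regroup by hooks. As [u + v = 1], the hook of
    index [k] gets weight ['X^k (1 - 'X)^(n - 1 - k)], whose Beta integral is the inverse of [n]
    times its degree. *)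
Lemma sum_hook_char_inv g :
  \sum_(k < n) hook_char k g / hook_char k 1%g =
  n%:R * integral01 (\prod_(C in porbits g) ((1 - 'X) ^+ #|C| - (- 'X) ^+ #|C|)).
Proof.
pose B k : {poly algC} := 'X^k * (1 - 'X) ^+ (n - k).
have -> : \prod_(C in porbits g) ((1 - 'X) ^+ #|C| - (- 'X) ^+ #|C|) =
    \sum_(k < n.+1) ext_char k g *: B k.
  rewrite (eq_bigr (fun k : 'I_n.+1 => polyC (ext_char k g) * B k)); last first.
    by move=> k _; rewrite mul_polyC.
  by rewrite (sum_ext_char polyC) -sum_invariant_sets card_ord.
rewrite sum_ext_char_hook hook_char_n scale0r add0r linear_sum mulr_sumr.
apply: eq_bigr => k _; rewrite linearZ /= hook_char1 //.
have -> : B k + B k.+1 = 'X^k * (1 - 'X) ^+ (n.-1 - k).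
  rewrite /B exprSr -mulrA -mulrDr; have kn := ltn_ord k.
  have -> : (n - k = (n.-1 - k).+1)%N by lia.
  have -> : (n - k.+1 = n.-1 - k)%N by lia.
  by rewrite exprS -mulrDl subrK mul1r.
have kn : (k <= n.-1)%N by rewrite -ltnS prednK.
rewrite integral01_beta subnKC // prednK // natrM invfM mulrCA [n%:R * _]mulrA.
by rewrite divff ?mul1r // pnatr_eq0 -lt0n.
Qed.

Lemma is_n_cycleV g : is_n_cycle g^-1%g = is_n_cycle g.
Proof. by rewrite /is_n_cycle /has_rect_cycle_type porbitsV. Qed.

(** Write both indicators as alternating sums of hooks, the one of [x] being taken at its inverse.
    Convolution keeps only the diagonal terms, whose signs square to 1, and leaves the sum of
    [sum_hook_char_inv]. *)
Lemma card_n_cycle_pairs y :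
  #|[set x : 'S_n | is_n_cycle x & is_n_cycle (x * y)%g]|%:R * n%:R =
  n`!%:R * integral01 (\prod_(C in porbits y) ((1 - 'X) ^+ #|C| - (- 'X) ^+ #|C|)) :> algC.
Proof.
have nz : n%:R != 0 :> algC by rewrite pnatr_eq0 -lt0n.
apply: (mulIf nz); rewrite -[RHS]mulrA [integral01 _ * _]mulrC -sum_hook_char_inv.
transitivity (\sum_(x in [set: 'S_n]) (\sum_(k < n) (-1) ^+ k * hook_char k (x * y)%g) *
    (\sum_(l < n) (-1) ^+ l * hook_char l x^-1%g)).
  rewrite -sum1_card natr_sum -mulrA mulr_suml big_mkcond [RHS]big_mkcond /=.
  apply: eq_bigr => x _; rewrite !is_n_cycle_hook is_n_cycleV !inE andbC.
  by do 2!case: is_n_cycle => /=; rewrite ?mulr0 ?mul0r ?mulr1 ?mul1r.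
under eq_bigr do rewrite big_distrlr /=.
rewrite exchange_big mulr_sumr; apply: eq_bigr => k _; rewrite exchange_big /=.
transitivity (\sum_(l < n) (-1) ^+ k * (-1) ^+ l *
    (n`!%:R * ((k == l)%:R * (hook_char k y / hook_char k 1%g)))).
  apply: eq_bigr => l _; rewrite -(cfdot_hook_char (ltn_ord k) (ltn_ord l)).
  rewrite -(card_Sn n) -cardsT.
  rewrite -dirr_convolution ?hook_char_dirr // mulr_sumr.
  by apply: eq_bigr => x _; rewrite mulrACA.
rewrite (bigD1 k) //= big1 => [|l /negPf lk].
  by rewrite eqxx mul1r addr0 -exprD addnn -signr_odd odd_double mul1r.
by rewrite eq_sym lk mul0r !mulr0.
Qed.

(** The case [y = 1] of the pair count: every cycle is a point, with factor [(1 - t) + t = 1]. *)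
Lemma card_n_cycles : #|[set x : 'S_n | is_n_cycle x]|%:R * n%:R = n`!%:R :> algC.
Proof.
have := card_n_cycle_pairs 1%g.
have -> : [set x : 'S_n | is_n_cycle x & is_n_cycle (x * 1)%g] = [set x | is_n_cycle x].
  by apply/setP => x; rewrite !inE mulg1 andbb.
move=> ->; rewrite big1 => [|C /imsetP[i _ ->]].
  by rewrite -(expr0 'X) integral01Xn invr1 mulr1.
have -> : porbit 1%g i = [set i].
  by apply/setP => j; rewrite inE; apply/porbitP/eqP => [[k ->]|->];
    [rewrite expg1n perm1 | exists 0; rewrite expg0 perm1].
by rewrite cards1 !expr1 opprK subrK.
Qed.

End Hooks.

(** * The integral formula for [N] and the lower bound *)

Lemma has_rect_cycle_typeJ n b q (g p : 'S_n) :
  has_rect_cycle_type b q (g ^ p)%g = has_rect_cycle_type b q g.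
Proof.
have pE x : porbit (g ^ p)%g (p x) = p @: porbit g x.
  apply/setP => y; apply/porbitP/imsetP => [[i ->]|[_ /porbitP[i ->] ->]].
    by exists ((g ^+ i)%g x); rewrite ?mem_porbit // -conjXg permJ.
  by exists i; rewrite -conjXg permJ.
rewrite /has_rect_cycle_type.
have -> : porbits (g ^ p)%g = [set p @: C | C : {set 'I_n} in porbits g].
  apply/setP => C; apply/imsetP/imsetP => [[x _ ->]|[_ /imsetP[x _ ->] ->]].
    by exists (porbit g (p^-1%g x)); rewrite ?imset_f //= -pE permKV.
  by exists (p x); rewrite //= pE.
rewrite (card_imset _ (imset_inj (@perm_inj _ p))); congr (_ && _).
apply/forall_inP/forall_inP => H C CP.
  rewrite -(card_imset C (@perm_inj _ p)).
  by apply: (H (p @: C)); apply/imsetP; exists C.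
by case/imsetP: CP => D DP -> /=; rewrite (card_imset _ (@perm_inj _ p)) H.
Qed.

Lemma long_cycleX n (i : 'I_n) k : (long_cycle n ^+ k)%g i = ((i + k) %% n)%N :> nat.
Proof.
elim: k => [|k IH]; first by rewrite expg0 perm1 addn0 modn_small.
by rewrite expgSr permM permE /= IH -addn1 modnDml addn1 addnS.
Qed.

Lemma n_cycle_conj n (x : 'S_n) : (0 < n)%N -> is_n_cycle x ->
  exists p : 'S_n, x = (long_cycle n ^ p)%g.
Proof.
move=> n0 /andP[_ /forall_inP xC]; pose i0 := Ordinal n0.
have ci : #|porbit x i0| = n by apply/eqP/xC/imset_f.
have fI : injective (fun j : 'I_n => iter j x i0).
  move=> i j /= ij; have := uniq_traject_porbit x i0; rewrite ci => U.
  apply/val_inj/eqP; rewrite -(nth_uniq i0 _ _ U) ?size_traject ?(valP i) ?(valP j) //.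
  by rewrite !nth_traject ?(valP i) ?(valP j) //; apply/eqP.
(* The conjugator sends [j] to [x^j(i0)]; only the last index wraps around, where [x^n] fixes
   [i0]. *)
exists (perm fI); apply/permP => y; rewrite -[y](permKV (perm fI)).
set j := ((perm fI)^-1%g y); rewrite permJ !permE /= -[LHS]iterS.
have [lt|nj] := ltnP j.+1 n; first by rewrite modn_small.
have -> : j.+1 = n by apply/eqP; rewrite eqn_leq nj ltn_ord.
by rewrite modnn -[X in iter X _ _ = _]ci iter_porbit.
Qed.

Lemma card_transported_N n b q (x : 'S_n) : (0 < n)%N -> is_n_cycle x ->
  #|[set y : 'S_n | has_rect_cycle_type b q y & is_n_cycle (x * y)%g]| = N n b q.
Proof.
move=> n0 /(n_cycle_conj n0)[p ->].
rewrite /N -(card_preimset _ (conjg_inj p)); apply: eq_card => y.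
by rewrite !inE has_rect_cycle_typeJ -conjMg /is_n_cycle has_rect_cycle_typeJ.
Qed.

Lemma N_integral n b q : (0 < n)%N ->
  (N n b q)%:R = (T n b q)%:R * integral01 (((1 - 'X) ^+ b - (- 'X) ^+ b) ^+ q) :> algC.
Proof.
move=> n0; set I := integral01 _.
have nf : n`!%:R != 0 :> algC by rewrite pnatr_eq0 -lt0n fact_gt0.
apply: (mulfI nf); rewrite -{1}(card_n_cycles n0) mulrAC.
rewrite mulrCA -natrM.
(* Double counting of the pairs [(x, y)]: by conjugation, every n-cycle [x] admits [N n b q] choices
   of [y]. *)
have <- : (\sum_(y | has_rect_cycle_type b q y)
    #|[set x : 'S_n | is_n_cycle x & is_n_cycle (x * y)%g]| =
    #|[set x : 'S_n | is_n_cycle x]| * N n b q)%N.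
  transitivity (\sum_(x : 'S_n | is_n_cycle x)
     #|[set y : 'S_n | has_rect_cycle_type b q y & is_n_cycle (x * y)%g]|)%N.
    under eq_bigr do rewrite -sum1dep_card.
    rewrite (exchange_big_dep (fun x : 'S_n => is_n_cycle x)) /=; last first.
      by move=> y x _ /andP[].
    apply: eq_bigr => x xn; rewrite -sum1dep_card.
    by apply: eq_bigl => y; rewrite xn.
  rewrite -sum_nat_const; apply: eq_big => [x|x]; first by rewrite inE.
  exact: card_transported_N.
rewrite natr_sum mulr_suml /T -sum1_card natr_sum mulr_suml.
apply: eq_big => [y|y /andP[/eqP yq /forall_inP yb]]; first by rewrite inE.
rewrite card_n_cycle_pairs // mul1r; congr (_ * integral01 _).
rewrite (eq_bigr (fun=> (1 - 'X) ^+ b - (- 'X) ^+ b)) ?prodr_const ?yq //.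
by move=> C /yb/eqP->.
Qed.

(** The cycles of this power are the residue classes modulo [q]. It serves to show that [T] is
    nonzero. *)
Lemma long_cycleX_rect b q : (0 < b)%N -> (0 < q)%N ->
  has_rect_cycle_type b q (long_cycle (b * q) ^+ q)%g.
Proof.
move=> b0 q0; set n := (b * q)%N; set g := (_ ^+ q)%g.
pose K r : {set 'I_n} := [set j : 'I_n | (j %% q == r)%N].
have gX m i : (g ^+ m)%g i = ((i + q * m) %% n)%N :> nat.
  by rewrite /g -expgM long_cycleX.
have pE i : porbit g i = K (i %% q)%N.
  apply/setP => j; rewrite inE; apply/porbitP/eqP => [[m ->]|ij].
    by rewrite gX modn_dvdm ?dvdn_mull // addnC mulnC modnMDl.
  (* The exponent is the difference of the quotients by [q], shifted by [b] so that truncated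
     subtraction does no harm. *)
  exists (j %/ q + (b - i %/ q))%N; apply/val_inj; rewrite /= gX.
  have ib : (i %/ q <= b)%N by rewrite ltnW // ltn_divLR.
  have -> : (i + q * (j %/ q + (b - i %/ q)) = j + n)%N.
    rewrite {1}(divn_eq i q) {2}(divn_eq j q) ij /n; nia.
  by rewrite modnDr modn_small.
have lt_rn r m : (r < q)%N -> (m < b)%N -> (m * q + r < n)%N.
  move=> rq mb; apply: (@leq_trans (m.+1 * q)); last by rewrite leq_mul2r mb orbT.
  by rewrite mulSn addnC ltn_add2r.
have Kc (r : 'I_q) : #|K r| = b.
  rewrite -[RHS]card_ord -(card_imset _ (_ : injective (fun m : 'I_b =>
    Ordinal (lt_rn r m (ltn_ord r) (ltn_ord m))))).
    apply: eq_card => j; rewrite inE; apply/eqP/imsetP => [jr|[m _ ->]].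
      have jb : (j %/ q < b)%N by rewrite ltn_divLR.
      by exists (Ordinal jb) => //; apply/val_inj; rewrite /= [LHS](divn_eq j q) jr.
    by rewrite /= modnMDl modn_small.
  move=> m m' /(congr1 val) /= /eqP; rewrite eqn_add2r eqn_pmul2r // => /eqP.
  exact: val_inj.
have PE : porbits g = [set K (val r) | r : 'I_q].
  apply/setP => C; apply/imsetP/imsetP => [[i _ ->]|[r _ ->]].
    by exists (Ordinal (ltn_pmod i q0)); rewrite ?pE.
  have rn : (r < n)%N by rewrite -[X in (X < _)%N]add0n -(mul0n q) lt_rn.
  by exists (Ordinal rn); rewrite ?pE //= modn_small.
rewrite /has_rect_cycle_type PE card_imset ?card_ord ?eqxx /=.
  by apply/forall_inP => _ /imsetP[r _ ->]; rewrite Kc.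
move=> r s rs; have rn : (r < n)%N by rewrite -[X in (X < _)%N]add0n -(mul0n q) lt_rn.
have : Ordinal rn \in K s by rewrite -rs inE /= modn_small.
by rewrite inE /= modn_small // => /eqP/val_inj.
Qed.

Theorem theorem3p3 (n b q : nat) (hn : (3 <= n)%N) (hnbq : n = (b * q)%N)
  (hb : (2 <= b)%N) (hq : (0 < q)%N) (hpar : n = q %[mod 2]) :
  ((N n b q)%:R / (T n b q)%:R >= 2 / (n + 2)%:R :> rat)
  /\ (b = 2%N -> (N n b q)%:R / (T n b q)%:R = 2 / (n + 2)%:R :> rat).
Proof.
have T0 : (T n b q)%:R != 0 :> algC.
  rewrite pnatr_eq0 -lt0n; apply/card_gt0P; exists (long_cycle n ^+ q)%g.
  by rewrite inE hnbq long_cycleX_rect // ltnW.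
have n0 : (0 < n)%N := ltnW (ltnW hn).
have NT : (N n b q)%:R / (T n b q)%:R =
    integral01 (((1 - 'X) ^+ b - (- 'X) ^+ b) ^+ q) :> algC.
  by rewrite N_integral // mulrC mulKf.
(* The congruence of [n] and [q] modulo 2 in the form used by [rect_integral_ge]; for [b = 2] it
   makes [q] even. *)
have par : ~~ odd (b * q + q).
  by rewrite -hnbq oddD; move: hpar; rewrite !modn2; do 2!case: odd.
split=> [|b2].
  by rewrite -(ler_rat algC) !fmorph_div /= !ratr_nat /= NT hnbq rect_integral_ge.
apply: (fmorph_inj (@ratr algC)); rewrite !fmorph_div /= !ratr_nat /= NT.
rewrite hnbq b2 rect2_integral //.
by move: par; rewrite b2 oddD oddM.
Qed.
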